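(* Let $\mathcal{C}$ be an autonomous (rigid) category and let $T$ be a star-autonomous monad on $\mathcal{C}$. Then $T$, with its underlying bimonad (comonoidal monad) structure, is a Hopf monad on $\mathcal{C}$ in the sense of Bruguières–Virelizier.
   Context: Associativity and unit isomorphisms are suppressed. An autonomous (rigid) category is a monoidal category $(\mathcal{D},\otimes,I)$ in which every object $A$ has a left dual $SA$, with $e_A:SA\otimes A\to I$, $n_A:I\to A\otimes SA$, and a right dual $S'A$, with $e'_A:A\otimes S'A\to I$, $n'_A:I\to S'A\otimes A$, satisfying the usual triangle identities. It is regarded as a star-autonomous category with left and right star operations the contravariant functors $S,S'$, the canonical isomorphisms $SS'A\cong A\cong S'SA$, and the evaluation morphisms $e_{A,B}=(S(A\otimes B)\otimes A\xrightarrow{1\otimes1\otimes n_B}S(A\otimes B)\otimes A\otimes B\otimes SB\xrightarrow{e_{A\otimes B}\otimes1}SB)$, $e'_{B,A}=(B\otimes S'(A\otimes B)\xrightarrow{n'_A\otimes1\otimes1}S'A\otimes A\otimes B\otimes S'(A\otimes B)\xrightarrow{1\otimes e'_{A\otimes B}}S'A)$. (Equivalently, it is a linearly distributive category with negations in which both tensor products coincide.) **Star-autonomous comonad.** A star-autonomous comonad on $\mathcal{D}$ is a comonad $(G,\delta,\epsilon)$ which is a monoidal comonad (i.e. $G$ is lax monoidal via $\phi_{A,B}:GA\otimes GB\to G(A\otimes B)$, $\phi_0:I\to GI$, and $\delta,\epsilon$ are monoidal natural transformations) together with natural transformations $\nu:S\to GSG$, $\nu':S'\to GS'G$ such that for all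 objects $A,B$: (0) $\epsilon_{SGA}\nu_A=S\epsilon_A$ and $\delta_{SGA}\nu_A=G^2S(\delta_A)\,G(\nu_{GA})\,\nu_A$, and the same with $S',\nu'$ in place of $S,\nu$; (1) $GS(\nu'_A)\circ\nu_{S'GA}:SS'GA\to GSS'A$ equals the canonical isomorphism $SS'GA\cong GA\cong GSS'A$; (2) $GS'(\nu_A)\circ\nu'_{SGA}:S'SGA\to GS'SA$ equals the canonical isomorphism $S'SGA\cong GA\cong GS'SA$; (3) $\nu_B\,e_{A,B}\,(1\otimes\epsilon_A)=G(e_{GA,GB})\,G(S\phi_{A,B}\otimes1)\,\phi\,(\nu_{A\otimes B}\otimes\delta_A):S(A\otimes B)\otimes GA\to GSGB$; (4) $\nu'_A\,e'_{B,A}\,(\epsilon_B\otimes1)=G(e'_{GB,GA})\,G(1\otimes S'\phi_{A,B})\,\phi\,(\delta_B\otimes\nu'_{A\otimes B}):GB\otimes S'(A\otimes B)\to GS'GA$. **Star-autonomous monad.** If $\mathcal{C}$ is autonomous, so is $\mathcal{C}^{\mathrm{op}}$ (with the same $\otimes$). A star-autonomous monad on $\mathcal{C}$ is the dual notion: a monad $T$ on $\mathcal{C}$ with structure making the corresponding comonad $T^{\mathrm{op}}$ on $\mathcal{C}^{\mathrm{op}}$ a star-autonomous comonad. In particular $T=(T,\mu,\eta)$ is a bimonad: $T$ is a comonoidal (opmonoidal) functor with $T_2(X,Y):T(X\otimes Y)\to TX\otimes TY$ and $T_0:TI\to I$ (the duals of $\phi,\phi_0$), and $\mu,\eta$ are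 comonoidal. **Hopf monad (Bruguières–Virelizier).** For $X$ in $\mathcal{C}$ let ${}^\vee X$ be a left dual with $\mathrm{ev}_X:{}^\vee X\otimes X\to I$, $\mathrm{coev}_X:I\to X\otimes{}^\vee X$, and $X^\vee$ a right dual with $\widetilde{\mathrm{ev}}_X:X\otimes X^\vee\to I$, $\widetilde{\mathrm{coev}}_X:I\to X^\vee\otimes X$. A Hopf monad on an autonomous category $\mathcal{C}$ is a bimonad $T$ that admits a left antipode and a right antipode. A left antipode is a natural transformation $s^l_X:T({}^\vee T(X))\to{}^\vee X$ such that for all $X$ $T_0\,T(\mathrm{ev}_X)\,T({}^\vee\eta_X\otimes1_X)=\mathrm{ev}_{TX}\,(s^l_{TX}\,T({}^\vee\mu_X)\otimes1_{TX})\,T_2({}^\vee TX,X)$, $(\eta_X\otimes1_{{}^\vee X})\,\mathrm{coev}_X\,T_0=(\mu_X\otimes s^l_X)\,T_2(TX,{}^\vee TX)\,T(\mathrm{coev}_{TX})$. A right antipode is a natural transformation $s^r_X:T(T(X)^\vee)\to X^\vee$ such that for all $X$ $T_0\,T(\widetilde{\mathrm{ev}}_X)\,T(1_X\otimes\eta_X^\vee)=\widetilde{\mathrm{ev}}_{TX}\,(1_{TX}\otimes s^r_{TX}\,T(\mu_X^\vee))\,T_2(X,(TX)^\vee)$, $(1_{X^\vee}\otimes\eta_X)\,\widetilde{\mathrm{coev}}_X\,T_0=(s^r_X\otimes\mu_X)\,T_2((TX)^\vee,TX)\,T(\widetilde{\mathrm{coev}}_{TX})$. *)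

(* Defs.v *)
From mathcomp Require Import ssreflect ssrfun.

Set Implicit Arguments.
Unset Strict Implicit.
Unset Printing Implicit Defensive.

Declare Scope cat_scope.
Delimit Scope cat_scope with cat.
Local Open Scope cat_scope.

Reserved Notation "g ∘ f" (at level 40, left associativity).
Reserved Notation "A ⊗ B" (at level 35, right associativity).
Reserved Notation "f ⊗₁ g" (at level 35, right associativity).

(** ** Categories, functors, monads and comonads *)

Record category := Category {
  ob :> Type;
  hom : ob -> ob -> Type;
  idm : forall A, hom A A;
  comp : forall A B C, hom B C -> hom A B -> hom A C;
  comp1m : forall A B (f : hom A B), comp (idm B) f = f;
  compm1 : forall A B (f : hom A B), comp f (idm A) = f;
  compA : forall A B C D (h : hom C D) (g : hom B C) (f : hom A B),
    comp h (comp g f) = comp (comp h g) f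
}.
Arguments hom {c} A B.
Arguments idm {c} A.
Arguments comp {c A B C} g f.

Notation "g ∘ f" := (comp g f) : cat_scope.

Record functor (C D : category) := Functor {
  fob :> C -> D;
  fmap : forall A B : C, hom A B -> hom (fob A) (fob B);
  fmap1 : forall A, fmap (idm A) = idm (fob A);
  fmapM : forall A B E (g : hom B E) (f : hom A B),
    fmap (g ∘ f) = fmap g ∘ fmap f
}.
Arguments fmap {C D} F {A B} f : rename.

Record comonad (C : category) := Comonad {
  comonad_functor :> functor C C;
  comult : forall A, hom (comonad_functor A) (comonad_functor (comonad_functor A));
  counit : forall A, hom (comonad_functor A) A;
  comult_natural : forall A B (f : hom A B),
    fmap comonad_functor (fmap comonad_functor f) ∘ comult A
    = comult B ∘ fmap comonad_functor f;
  counit_natural : forall A B (f : hom A B),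
    f ∘ counit A = counit B ∘ fmap comonad_functor f;
  comult_coassoc : forall A,
    comult (comonad_functor A) ∘ comult A
    = fmap comonad_functor (comult A) ∘ comult A;
  comult_counitl : forall A,
    counit (comonad_functor A) ∘ comult A = idm (comonad_functor A);
  comult_counitr : forall A,
    fmap comonad_functor (counit A) ∘ comult A = idm (comonad_functor A)
}.
Arguments comult {C} G A : rename.
Arguments counit {C} G A : rename.

Record monad (C : category) := Monad {
  monad_functor :> functor C C;
  mu : forall A, hom (monad_functor (monad_functor A)) (monad_functor A);
  eta : forall A, hom A (monad_functor A);
  mu_natural : forall A B (f : hom A B),
    mu B ∘ fmap monad_functor (fmap monad_functor f)
    = fmap monad_functor f ∘ mu A;
  eta_natural : forall A B (f : hom A B),
    eta B ∘ f = fmap monad_functor f ∘ eta A;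
  mu_assoc : forall A,
    mu A ∘ mu (monad_functor A) = mu A ∘ fmap monad_functor (mu A);
  mu_unitl : forall A,
    mu A ∘ eta (monad_functor A) = idm (monad_functor A);
  mu_unitr : forall A,
    mu A ∘ fmap monad_functor (eta A) = idm (monad_functor A)
}.
Arguments mu {C} T A : rename.
Arguments eta {C} T A : rename.

(** ** Monoidal categories *)

Record monoidal_category := MonoidalCategory {
  mon_cat :> category;
  I : mon_cat;
  tens : mon_cat -> mon_cat -> mon_cat;
  tensm : forall A A' B B' : mon_cat,
    hom A A' -> hom B B' -> hom (tens A B) (tens A' B');
  tensm1 : forall A B, tensm (idm A) (idm B) = idm (tens A B);
  tensmM : forall A A' A'' B B' B'' (f' : hom A' A'') (f : hom A A')
      (g' : hom B' B'') (g : hom B B'),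
    tensm (f' ∘ f) (g' ∘ g) = tensm f' g' ∘ tensm f g;
  assoc : forall A B C, hom (tens (tens A B) C) (tens A (tens B C));
  assocV : forall A B C, hom (tens A (tens B C)) (tens (tens A B) C);
  lunit : forall A, hom (tens I A) A;
  lunitV : forall A, hom A (tens I A);
  runit : forall A, hom (tens A I) A;
  runitV : forall A, hom A (tens A I);
  assocK : forall A B C, assocV A B C ∘ assoc A B C = idm _;
  assocVK : forall A B C, assoc A B C ∘ assocV A B C = idm _;
  lunitK : forall A, lunitV A ∘ lunit A = idm _;
  lunitVK : forall A, lunit A ∘ lunitV A = idm _;
  runitK : forall A, runitV A ∘ runit A = idm _;
  runitVK : forall A, runit A ∘ runitV A = idm _;
  assoc_natural : forall A A' B B' C C'
      (f : hom A A') (g : hom B B') (h : hom C C'),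
    assoc A' B' C' ∘ tensm (tensm f g) h
    = tensm f (tensm g h) ∘ assoc A B C;
  lunit_natural : forall A B (f : hom A B),
    lunit B ∘ tensm (idm I) f = f ∘ lunit A;
  runit_natural : forall A B (f : hom A B),
    runit B ∘ tensm f (idm I) = f ∘ runit A;
  pentagon : forall A B C D,
    assoc A B (tens C D) ∘ assoc (tens A B) C D
    = tensm (idm A) (assoc B C D) ∘ assoc A (tens B C) D
      ∘ tensm (assoc A B C) (idm D);
  triangle : forall A B,
    tensm (idm A) (lunit B) ∘ assoc A I B = tensm (runit A) (idm B)
}.
Arguments I {m}.
Arguments tens {m} A B.
Arguments tensm {m A A' B B'} f g.
Arguments assoc {m} A B C.
Arguments assocV {m} A B C.
Arguments lunit {m} A.
Arguments lunitV {m} A.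
Arguments runit {m} A.
Arguments runitV {m} A.

Notation "A ⊗ B" := (tens A B) : cat_scope.
Notation "f ⊗₁ g" := (tensm f g) : cat_scope.

Record monoidal_comonad (D : monoidal_category) := MonoidalComonad {
  mc_comonad :> comonad D;
  phi : forall A B, hom (mc_comonad A ⊗ mc_comonad B) (mc_comonad (A ⊗ B));
  phi0 : hom I (mc_comonad I);
  phi_natural : forall A A' B B' (f : hom A A') (g : hom B B'),
    fmap mc_comonad (f ⊗₁ g) ∘ phi A B
    = phi A' B' ∘ (fmap mc_comonad f ⊗₁ fmap mc_comonad g);
  phi_assoc : forall A B C,
    fmap mc_comonad (assoc A B C) ∘ phi (A ⊗ B) C
      ∘ (phi A B ⊗₁ idm (mc_comonad C))
    = phi A (B ⊗ C) ∘ (idm (mc_comonad A) ⊗₁ phi B C)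
      ∘ assoc (mc_comonad A) (mc_comonad B) (mc_comonad C);
  phi_lunit : forall A,
    fmap mc_comonad (lunit A) ∘ phi I A ∘ (phi0 ⊗₁ idm (mc_comonad A))
    = lunit (mc_comonad A);
  phi_runit : forall A,
    fmap mc_comonad (runit A) ∘ phi A I ∘ (idm (mc_comonad A) ⊗₁ phi0)
    = runit (mc_comonad A);
  comult_phi : forall A B,
    comult mc_comonad (A ⊗ B) ∘ phi A B
    = fmap mc_comonad (phi A B) ∘ phi (mc_comonad A) (mc_comonad B)
      ∘ (comult mc_comonad A ⊗₁ comult mc_comonad B);
  comult_phi0 : comult mc_comonad I ∘ phi0 = fmap mc_comonad phi0 ∘ phi0;
  counit_phi : forall A B,
    counit mc_comonad (A ⊗ B) ∘ phi A B
    = counit mc_comonad A ⊗₁ counit mc_comonad B;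
  counit_phi0 : counit mc_comonad I ∘ phi0 = idm I
}.
Arguments phi {D} G A B : rename.
Arguments phi0 {D} G : rename.

Record bimonad (C : monoidal_category) := Bimonad {
  bm_monad :> monad C;
  T2 : forall X Y, hom (bm_monad (X ⊗ Y)) (bm_monad X ⊗ bm_monad Y);
  T0 : hom (bm_monad I) I;
  T2_natural : forall X X' Y Y' (f : hom X X') (g : hom Y Y'),
    T2 X' Y' ∘ fmap bm_monad (f ⊗₁ g)
    = (fmap bm_monad f ⊗₁ fmap bm_monad g) ∘ T2 X Y;
  T2_coassoc : forall X Y Z,
    assoc (bm_monad X) (bm_monad Y) (bm_monad Z)
      ∘ (T2 X Y ⊗₁ idm (bm_monad Z)) ∘ T2 (X ⊗ Y) Z
    = (idm (bm_monad X) ⊗₁ T2 Y Z) ∘ T2 X (Y ⊗ Z)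
      ∘ fmap bm_monad (assoc X Y Z);
  T2_lunit : forall X,
    lunit (bm_monad X) ∘ (T0 ⊗₁ idm (bm_monad X)) ∘ T2 I X
    = fmap bm_monad (lunit X);
  T2_runit : forall X,
    runit (bm_monad X) ∘ (idm (bm_monad X) ⊗₁ T0) ∘ T2 X I
    = fmap bm_monad (runit X);
  T2_mu : forall X Y,
    T2 X Y ∘ mu bm_monad (X ⊗ Y)
    = (mu bm_monad X ⊗₁ mu bm_monad Y)
      ∘ T2 (bm_monad X) (bm_monad Y) ∘ fmap bm_monad (T2 X Y);
  T0_mu : T0 ∘ mu bm_monad I = T0 ∘ fmap bm_monad T0;
  T2_eta : forall X Y,
    T2 X Y ∘ eta bm_monad (X ⊗ Y) = eta bm_monad X ⊗₁ eta bm_monad Y;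
  T0_eta : T0 ∘ eta bm_monad I = idm I
}.
Arguments T2 {C} T X Y : rename.
Arguments T0 {C} T : rename.

(** ** Autonomous categories *)

Record autonomous_category := AutonomousCategory {
  aut_mon :> monoidal_category;
  ldual : aut_mon -> aut_mon;
  evl : forall A, hom (ldual A ⊗ A) I;
  coevl : forall A, hom I (A ⊗ ldual A);
  rdual : aut_mon -> aut_mon;
  evr : forall A, hom (A ⊗ rdual A) I;
  coevr : forall A, hom I (rdual A ⊗ A);
  ldual_triangle : forall A,
    runit A ∘ (idm A ⊗₁ evl A) ∘ assoc A (ldual A) A
      ∘ (coevl A ⊗₁ idm A) ∘ lunitV A = idm A;
  ldual_triangle_dual : forall A,
    lunit (ldual A) ∘ (evl A ⊗₁ idm (ldual A))
      ∘ assocV (ldual A) A (ldual A)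
      ∘ (idm (ldual A) ⊗₁ coevl A) ∘ runitV (ldual A) = idm (ldual A);
  rdual_triangle : forall A,
    lunit A ∘ (evr A ⊗₁ idm A) ∘ assocV A (rdual A) A
      ∘ (idm A ⊗₁ coevr A) ∘ runitV A = idm A;
  rdual_triangle_dual : forall A,
    runit (rdual A) ∘ (idm (rdual A) ⊗₁ evr A)
      ∘ assoc (rdual A) A (rdual A)
      ∘ (coevr A ⊗₁ idm (rdual A)) ∘ lunitV (rdual A) = idm (rdual A)
}.
Arguments ldual {a} A.
Arguments rdual {a} A.
Arguments evl {a} A.
Arguments evr {a} A.
Arguments coevl {a} A.
Arguments coevr {a} A.

(* The contravariant functors S and S' on arrows: mates with respect to the
   chosen left duals SA = ldual A and right duals S'A = rdual A. *)
Definition ldual_map (D : autonomous_category) (A B : D) (f : hom A B) :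
    hom (ldual B) (ldual A) :=
  lunit (ldual A) ∘ (evl B ⊗₁ idm (ldual A))
    ∘ assocV (ldual B) B (ldual A)
    ∘ (idm (ldual B) ⊗₁ (f ⊗₁ idm (ldual A)))
    ∘ (idm (ldual B) ⊗₁ coevl A) ∘ runitV (ldual B).

Definition rdual_map (D : autonomous_category) (A B : D) (f : hom A B) :
    hom (rdual B) (rdual A) :=
  runit (rdual A) ∘ (idm (rdual A) ⊗₁ evr B)
    ∘ (idm (rdual A) ⊗₁ (f ⊗₁ idm (rdual B)))
    ∘ assoc (rdual A) A (rdual B)
    ∘ (coevr A ⊗₁ idm (rdual B)) ∘ lunitV (rdual B).

(* The canonical isomorphisms SS'A ≅ A ≅ S'SA: an object and its double dual
   are both duals of the same object. *)
Definition ldual_rdual (D : autonomous_category) (A : D) :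
    hom (ldual (rdual A)) A :=
  lunit A ∘ (evl (rdual A) ⊗₁ idm A) ∘ assocV (ldual (rdual A)) (rdual A) A
    ∘ (idm (ldual (rdual A)) ⊗₁ coevr A) ∘ runitV (ldual (rdual A)).

Definition ldual_rdualV (D : autonomous_category) (A : D) :
    hom A (ldual (rdual A)) :=
  lunit (ldual (rdual A)) ∘ (evr A ⊗₁ idm (ldual (rdual A)))
    ∘ assocV A (rdual A) (ldual (rdual A))
    ∘ (idm A ⊗₁ coevl (rdual A)) ∘ runitV A.

Definition rdual_ldual (D : autonomous_category) (A : D) :
    hom (rdual (ldual A)) A :=
  runit A ∘ (idm A ⊗₁ evr (ldual A)) ∘ assoc A (ldual A) (rdual (ldual A))
    ∘ (coevl A ⊗₁ idm (rdual (ldual A))) ∘ lunitV (rdual (ldual A)).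

Definition rdual_ldualV (D : autonomous_category) (A : D) :
    hom A (rdual (ldual A)) :=
  runit (rdual (ldual A)) ∘ (idm (rdual (ldual A)) ⊗₁ evl A)
    ∘ assoc (rdual (ldual A)) (ldual A) A
    ∘ (coevr (ldual A) ⊗₁ idm A) ∘ lunitV A.

(* The evaluations e_{A,B} and e'_{B,A} of the star-autonomous structure. *)
Definition star_evl (D : autonomous_category) (A B : D) :
    hom (ldual (A ⊗ B) ⊗ A) (ldual B) :=
  lunit (ldual B) ∘ (evl (A ⊗ B) ⊗₁ idm (ldual B))
    ∘ assocV (ldual (A ⊗ B)) (A ⊗ B) (ldual B)
    ∘ (idm (ldual (A ⊗ B)) ⊗₁ assocV A B (ldual B))
    ∘ assoc (ldual (A ⊗ B)) A (B ⊗ ldual B)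
    ∘ (idm (ldual (A ⊗ B) ⊗ A) ⊗₁ coevl B) ∘ runitV (ldual (A ⊗ B) ⊗ A).

Definition star_evr (D : autonomous_category) (B A : D) :
    hom (B ⊗ rdual (A ⊗ B)) (rdual A) :=
  runit (rdual A) ∘ (idm (rdual A) ⊗₁ evr (A ⊗ B))
    ∘ (idm (rdual A) ⊗₁ assocV A B (rdual (A ⊗ B)))
    ∘ assoc (rdual A) A (B ⊗ rdual (A ⊗ B))
    ∘ (coevr A ⊗₁ idm (B ⊗ rdual (A ⊗ B))) ∘ lunitV (B ⊗ rdual (A ⊗ B)).


(** ** Star-autonomous comonads *)

Record star_structure (D : autonomous_category) (G : monoidal_comonad D) :=
    StarStructure {
  nu : forall A, hom (ldual A) (G (ldual (G A)));
  nu' : forall A, hom (rdual A) (G (rdual (G A)));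
  nu_natural : forall A B (f : hom A B),
    fmap G (ldual_map (fmap G f)) ∘ nu B = nu A ∘ ldual_map f;
  nu'_natural : forall A B (f : hom A B),
    fmap G (rdual_map (fmap G f)) ∘ nu' B = nu' A ∘ rdual_map f;
  counit_nu : forall A,
    counit G (ldual (G A)) ∘ nu A = ldual_map (counit G A);
  comult_nu : forall A,
    comult G (ldual (G A)) ∘ nu A
    = fmap G (fmap G (ldual_map (comult G A))) ∘ fmap G (nu (G A)) ∘ nu A;
  counit_nu' : forall A,
    counit G (rdual (G A)) ∘ nu' A = rdual_map (counit G A);
  comult_nu' : forall A,
    comult G (rdual (G A)) ∘ nu' A
    = fmap G (fmap G (rdual_map (comult G A))) ∘ fmap G (nu' (G A)) ∘ nu' A;
  nu_nu' : forall A,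
    fmap G (ldual_map (nu' A)) ∘ nu (rdual (G A))
    = fmap G (ldual_rdualV A) ∘ ldual_rdual (G A);
  nu'_nu : forall A,
    fmap G (rdual_map (nu A)) ∘ nu' (ldual (G A))
    = fmap G (rdual_ldualV A) ∘ rdual_ldual (G A);
  nu_star_evl : forall A B,
    nu B ∘ star_evl A B ∘ (idm (ldual (A ⊗ B)) ⊗₁ counit G A)
    = fmap G (star_evl (G A) (G B))
      ∘ fmap G (ldual_map (phi G A B) ⊗₁ idm (G A))
      ∘ phi G (ldual (G (A ⊗ B))) (G A)
      ∘ (nu (A ⊗ B) ⊗₁ comult G A);
  nu'_star_evr : forall A B,
    nu' A ∘ star_evr B A ∘ (counit G B ⊗₁ idm (rdual (A ⊗ B)))
    = fmap G (star_evr (G B) (G A))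
      ∘ fmap G (idm (G B) ⊗₁ rdual_map (phi G A B))
      ∘ phi G (G B) (rdual (G (A ⊗ B)))
      ∘ (comult G B ⊗₁ nu' (A ⊗ B))
}.

(** ** Opposites *)

Definition op_cat (C : category) : category := {|
  ob := ob C;
  hom := fun A B => @hom C B A;
  idm := fun A => @idm C A;
  comp := fun _ _ _ g f => @comp C _ _ _ f g;
  comp1m := fun _ _ f => compm1 f;
  compm1 := fun _ _ f => comp1m f;
  compA := fun _ _ _ _ h g f => esym (compA f g h)
|}.

Definition op_functor (C D : category) (F : functor C D) :
  functor (op_cat C) (op_cat D) :=
  @Functor (op_cat C) (op_cat D) F (fun _ _ f => fmap F f)
    (fun A => fmap1 F A) (fun _ _ _ g f => fmapM F f g).

Definition op_monad (C : category) (T : monad C) : comonad (op_cat C) :=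
  @Comonad (op_cat C) (op_functor T) (mu T) (eta T)
    (fun _ _ f => mu_natural T f) (fun _ _ f => eta_natural T f)
    (fun A => mu_assoc T A) (fun A => mu_unitl T A)
    (fun A => mu_unitr T A).

Lemma inverse_uniq (C : category) (A B : C) (f f' : hom A B) (g : hom B A) :
  f ∘ g = idm B -> g ∘ f' = idm A -> f = f'.
Proof. by move=> fg gf'; rewrite -[f]compm1 -gf' compA fg comp1m. Qed.

Lemma tensm_inverse (D : monoidal_category) (A A' B B' : D)
    (f : hom A A') (f' : hom A' A) (g : hom B B') (g' : hom B' B) :
  f' ∘ f = idm A -> g' ∘ g = idm B -> (f' ⊗₁ g') ∘ (f ⊗₁ g) = idm (A ⊗ B).
Proof. by move=> ff gg; rewrite -tensmM ff gg tensm1. Qed.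

Lemma iso_square (C : category) (A B A' B' : C)
    (i : hom A B) (iV : hom B A) (j : hom A' B') (jV : hom B' A')
    (f : hom A A') (g : hom B B') :
  i ∘ iV = idm B -> jV ∘ j = idm A' -> j ∘ f = g ∘ i -> f ∘ iV = jV ∘ g.
Proof.
move=> iiV jVj jf.
by rewrite -[g]compm1 -iiV (compA g) -jf !compA jVj comp1m.
Qed.

Lemma assocV_natural (D : monoidal_category) (A A' B B' C C' : D)
    (f : hom A A') (g : hom B B') (h : hom C C') :
  ((f ⊗₁ g) ⊗₁ h) ∘ assocV A B C = assocV A' B' C' ∘ (f ⊗₁ (g ⊗₁ h)).
Proof.
exact: iso_square (assocVK A B C) (assocK A' B' C') (assoc_natural f g h).
Qed.

Lemma lunitV_natural (D : monoidal_category) (A B : D) (f : hom A B) :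
  (idm I ⊗₁ f) ∘ lunitV A = lunitV B ∘ f.
Proof. exact: iso_square (lunitVK A) (lunitK B) (lunit_natural f). Qed.

Lemma runitV_natural (D : monoidal_category) (A B : D) (f : hom A B) :
  (f ⊗₁ idm I) ∘ runitV A = runitV B ∘ f.
Proof. exact: iso_square (runitVK A) (runitK B) (runit_natural f). Qed.

Lemma pentagonV (D : monoidal_category) (A B C E : D) :
  assocV (A ⊗ B) C E ∘ assocV A B (C ⊗ E)
  = (assocV A B C ⊗₁ idm E)
    ∘ (assocV A (B ⊗ C) E ∘ (idm A ⊗₁ assocV B C E)).
Proof.
apply: (@inverse_uniq _ _ _ _ _ (assoc A B (C ⊗ E) ∘ assoc (A ⊗ B) C E)).
  rewrite -compA (compA (assocV A B (C ⊗ E))) assocK comp1m; exact: assocK.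
rewrite pentagon -!compA (compA (assoc A B C ⊗₁ _)).
rewrite tensm_inverse ?assocVK ?comp1m //.
rewrite (compA (assoc A (B ⊗ C) E)) assocVK comp1m.
by rewrite tensm_inverse ?comp1m ?assocVK.
Qed.

Lemma triangleV (D : monoidal_category) (A B : D) :
  assocV A I B ∘ (idm A ⊗₁ lunitV B) = runitV A ⊗₁ idm B.
Proof.
apply: (@inverse_uniq _ _ _ _ _ (runit A ⊗₁ idm B)).
  rewrite -triangle -compA (compA (idm A ⊗₁ lunitV B)).
  by rewrite tensm_inverse ?comp1m ?lunitK ?assocK.
by rewrite tensm_inverse ?comp1m ?runitVK.
Qed.

(* The tensor product is kept as it is, not reversed; only the structural
   isomorphisms are replaced by their inverses. *)
Definition op_monoidal (D : monoidal_category) : monoidal_category :=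
  @MonoidalCategory (op_cat D) (@I D) (@tens D)
    (fun _ _ _ _ f g => @tensm D _ _ _ _ f g)
    (@tensm1 D)
    (fun _ _ _ _ _ _ f' f g' g => @tensmM D _ _ _ _ _ _ f f' g g')
    (@assocV D) (@assoc D) (@lunitV D) (@lunit D) (@runitV D) (@runit D)
    (@assocK D) (@assocVK D) (@lunitK D) (@lunitVK D) (@runitK D) (@runitVK D)
    (fun _ _ _ _ _ _ f g h => assocV_natural f g h)
    (fun _ _ f => lunitV_natural f) (fun _ _ f => runitV_natural f)
    (@pentagonV D) (@triangleV D).

Lemma compA5 (C : category) (A1 A2 A3 A4 A5 A6 : C) (a : hom A5 A6)
    (b : hom A4 A5) (c : hom A3 A4) (d : hom A2 A3) (e : hom A1 A2) :
  a ∘ (b ∘ (c ∘ (d ∘ e))) = a ∘ b ∘ c ∘ d ∘ e.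
Proof. by rewrite !compA. Qed.

(* Reversing arrows turns a right dual into a left dual, and conversely. *)
Definition op_autonomous (C : autonomous_category) : autonomous_category :=
  @AutonomousCategory (op_monoidal C)
    (@rdual C) (@coevr C) (@evr C) (@ldual C) (@coevl C) (@evl C)
    (fun A => etrans (compA5 _ _ _ _ _) (rdual_triangle A))
    (fun A => etrans (compA5 _ _ _ _ _) (rdual_triangle_dual A))
    (fun A => etrans (compA5 _ _ _ _ _) (ldual_triangle A))
    (fun A => etrans (compA5 _ _ _ _ _) (ldual_triangle_dual A)).

Lemma fmap_inverse (C D : category) (F : functor C D) (A B : C)
    (f : hom A B) (g : hom B A) :
  g ∘ f = idm A -> fmap F g ∘ fmap F f = idm (F A).
Proof. by move=> gf; rewrite -fmapM gf fmap1. Qed.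

Section OpBimonad.
Context (C : monoidal_category) (T : bimonad C).
Implicit Types X Y Z : C.

Lemma T2_coassocV X Y Z :
  (T2 T X Y ⊗₁ idm (T Z)) ∘ (T2 T (X ⊗ Y) Z ∘ fmap T (assocV X Y Z))
  = assocV (T X) (T Y) (T Z)
    ∘ ((idm (T X) ⊗₁ T2 T Y Z) ∘ T2 T X (Y ⊗ Z)).
Proof.
rewrite compA.
apply: (iso_square (fmap_inverse T (assocVK X Y Z)) (assocK _ _ _)).
by rewrite compA T2_coassoc.
Qed.

Lemma T2_lunitV X :
  (T0 T ⊗₁ idm (T X)) ∘ (T2 T I X ∘ fmap T (lunitV X)) = lunitV (T X).
Proof.
rewrite compA -[RHS]compm1.
apply: (iso_square (fmap_inverse T (lunitVK X)) (lunitK _)).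
by rewrite compA T2_lunit comp1m.
Qed.

Lemma T2_runitV X :
  (idm (T X) ⊗₁ T0 T) ∘ (T2 T X I ∘ fmap T (runitV X)) = runitV (T X).
Proof.
rewrite compA -[RHS]compm1.
apply: (iso_square (fmap_inverse T (runitVK X)) (runitK _)).
by rewrite compA T2_runit comp1m.
Qed.

Lemma T2_muV X Y :
  T2 T X Y ∘ mu T (X ⊗ Y)
  = (mu T X ⊗₁ mu T Y) ∘ (T2 T (T X) (T Y) ∘ fmap T (T2 T X Y)).
Proof. by rewrite T2_mu compA. Qed.

End OpBimonad.

Definition op_bimonad (C : monoidal_category) (T : bimonad C) :
  monoidal_comonad (op_monoidal C) :=
  @MonoidalComonad (op_monoidal C) (op_monad T) (T2 T) (T0 T)
    (fun _ _ _ _ f g => T2_natural T f g)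
    (T2_coassocV T) (T2_lunitV T) (T2_runitV T)
    (T2_muV T) (T0_mu T) (T2_eta T) (T0_eta T).

(** ** Star-autonomous monads and Hopf monads *)

(* On the opposite category the left dual is the right dual of C, so nu of the
   structure below is a family T (rdual (T A)) -> rdual A in C. *)
Record star_autonomous_monad (C : autonomous_category) := StarAutonomousMonad {
  sam_bimonad :> bimonad C;
  sam_structure : @star_structure (op_autonomous C) (op_bimonad sam_bimonad)
}.

Record is_left_antipode (C : autonomous_category) (T : bimonad C)
    (s : forall X : C, hom (T (ldual (T X))) (ldual X)) : Prop := {
  left_antipode_natural : forall X Y (f : hom X Y),
    s X ∘ fmap T (ldual_map (fmap T f)) = ldual_map f ∘ s Y;
  left_antipode_ev : forall X,
    T0 T ∘ fmap T (evl X) ∘ fmap T (ldual_map (eta T X) ⊗₁ idm X)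
    = evl (T X) ∘ ((s (T X) ∘ fmap T (ldual_map (mu T X))) ⊗₁ idm (T X))
      ∘ T2 T (ldual (T X)) X;
  left_antipode_coev : forall X,
    (eta T X ⊗₁ idm (ldual X)) ∘ coevl X ∘ T0 T
    = (mu T X ⊗₁ s X) ∘ T2 T (T X) (ldual (T X)) ∘ fmap T (coevl (T X))
}.

Record is_right_antipode (C : autonomous_category) (T : bimonad C)
    (s : forall X : C, hom (T (rdual (T X))) (rdual X)) : Prop := {
  right_antipode_natural : forall X Y (f : hom X Y),
    s X ∘ fmap T (rdual_map (fmap T f)) = rdual_map f ∘ s Y;
  right_antipode_ev : forall X,
    T0 T ∘ fmap T (evr X) ∘ fmap T (idm X ⊗₁ rdual_map (eta T X))
    = evr (T X) ∘ (idm (T X) ⊗₁ (s (T X) ∘ fmap T (rdual_map (mu T X))))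
      ∘ T2 T X (rdual (T X));
  right_antipode_coev : forall X,
    (idm (rdual X) ⊗₁ eta T X) ∘ coevr X ∘ T0 T
    = (s X ⊗₁ mu T X) ∘ T2 T (rdual (T X)) (T X) ∘ fmap T (coevr (T X))
}.

Definition hopf_monad (C : autonomous_category) (T : bimonad C) : Prop :=
  (exists s, @is_left_antipode C T s) /\ (exists s, @is_right_antipode C T s).

(* Main.v *)
From mathcomp Require Import ssreflect ssrfun.
Require Import Defs.

Set Implicit Arguments.
Unset Strict Implicit.
Unset Printing Implicit Defensive.
Local Open Scope cat_scope.

(** The argument takes place in the opposite category D, where the monad is a
    comonad [G] and the right duals of C are the left duals S; it uses the
    monoidal category of [G]-coalgebras.  The axioms of a star-autonomous
    comonad imply that, for coalgebras [A] and [B], the objects [SA] and [S'A] are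
    again coalgebras, and that the evaluations [S(A ⊗ B) ⊗ A -> SB] and
    [B ⊗ S'(A ⊗ B) -> S'A] and the isomorphism [SS'A -> A] are coalgebra
    morphisms, and they are only used through these facts.

    The transformation [nu] need not itself be an antipode: the dualizing
    coalgebra [bot = S'I] is isomorphic in D to the unit, but its coaction may
    differ from [phi0].  For instance, for [G = k[Γ] ⊗ -] on
    finite-dimensional vector spaces, with [Γ] a finite group, multiplying [nu]
    on the left and [nu'] on the right by a fixed element of [Γ] preserves all
    the axioms.  The remedy is to take as left dual of [A] the coalgebra
    [S(A ⊗ bot)], whose underlying object is isomorphic to [SA]; this twist of
    [nu] is [antipode].  An antipode amounts to a coaction on [SA], for every
    coalgebra [A], for which [e_A : SA ⊗ A -> I] and [n_A : I -> A ⊗ SA] are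
    coalgebra morphisms to and from the unit coalgebra ([cmap_evl] and
    [cmap_coevl]); cofree coalgebras then give the antipode equations
    ([antipode_evl] and [antipode_coevl]).

    For [e_A] this holds because it is the composite
    [S(A ⊗ bot) ⊗ A -> S(bot) = SS'I -> I].  For [n_A], put [Y = A ⊗ SA] and
    [Z = A ⊗ S'A].  The pairing [Y ⊗ Z -> A ⊗ S'A -> bot], which contracts the
    middle factor [SA ⊗ A] first, is a coalgebra morphism by the case of [e_A],
    and transposes to a coalgebra morphism [q : Y -> SZ] ([bot_transpose]).
    Now [q] is split mono in D ([retractK]), and [q ∘ n_A] is the morphism
    [I -> SS'I -> SZ] dual to [A ⊗ S'A -> bot] ([bot_transpose_coevl]), which is
    a coalgebra morphism; hence so is [n_A].

    Reversing the tensor product exchanges S with S' and [nu] with [nu'], so the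
    antipode of [rev_star] gives the other antipode.  Equalities of morphisms
    into a dual are tested after pairing ([ldual_ext], [evr_ext],
    [rdual_ext]), which keeps the associativity constraints manageable. *)

(** * Coherence in a monoidal category *)

(** [precomp] and [precomp2] are the forms in which an equation between
    composites rewrites inside a right-nested composite. *)
Lemma precomp (C : category) (A B E X : C) (g : hom B E) (f : hom A B)
    (h : hom A E) :
  g ∘ f = h -> forall k : hom X A, g ∘ (f ∘ k) = h ∘ k.
Proof. by move=> <- k; rewrite compA. Qed.

Lemma precomp2 (C : category) (A B B' E X : C) (g : hom B E) (f : hom A B)
    (g' : hom B' E) (f' : hom A B') :
  g ∘ f = g' ∘ f' -> forall k : hom X A, g ∘ (f ∘ k) = g' ∘ (f' ∘ k).
Proof. by move=> gf k; rewrite !compA gf. Qed.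

Lemma epi_split (C : category) (A B E : C) (i : hom A B) (iV : hom B A)
    (f g : hom B E) :
  i ∘ iV = idm B -> f ∘ i = g ∘ i -> f = g.
Proof. by move=> iK fg; rewrite -[f]compm1 -[g]compm1 -iK !compA fg. Qed.

Lemma mono_split (C : category) (A B E : C) (i : hom A B) (iV : hom B A)
    (f g : hom E A) :
  iV ∘ i = idm A -> i ∘ f = i ∘ g -> f = g.
Proof. by move=> iK fg; rewrite -[f]comp1m -[g]comp1m -iK -!compA fg. Qed.

Section Monoidal.
Context (D : monoidal_category).
Implicit Types A B X Y : D.

Lemma tensm_id_comp A B B' B'' (g : hom B' B'') (f : hom B B') :
  (idm A ⊗₁ g) ∘ (idm A ⊗₁ f) = idm A ⊗₁ (g ∘ f).
Proof. by rewrite -tensmM comp1m. Qed.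

Lemma tensm_comp_id A A' A'' B (g : hom A' A'') (f : hom A A') :
  (g ⊗₁ idm B) ∘ (f ⊗₁ idm B) = (g ∘ f) ⊗₁ idm B.
Proof. by rewrite -tensmM comp1m. Qed.

Lemma tensm_lr A A' B B' (f : hom A A') (g : hom B B') :
  (f ⊗₁ idm B') ∘ (idm A ⊗₁ g) = f ⊗₁ g.
Proof. by rewrite -tensmM comp1m compm1. Qed.

Lemma tensm_rl A A' B B' (f : hom A A') (g : hom B B') :
  (idm A' ⊗₁ g) ∘ (f ⊗₁ idm B) = f ⊗₁ g.
Proof. by rewrite -tensmM comp1m compm1. Qed.

Lemma tensm_swap A A' B B' (f : hom A A') (g : hom B B') :
  (idm A' ⊗₁ g) ∘ (f ⊗₁ idm B) = (f ⊗₁ idm B') ∘ (idm A ⊗₁ g).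
Proof. by rewrite tensm_lr tensm_rl. Qed.

Lemma tensI_inj A B (f g : hom A B) : idm I ⊗₁ f = idm I ⊗₁ g -> f = g.
Proof.
move=> fg; apply: (epi_split (lunitVK A)).
by rewrite -!lunit_natural fg.
Qed.

Lemma tensmI_inj A B (f g : hom A B) : f ⊗₁ idm I = g ⊗₁ idm I -> f = g.
Proof.
move=> fg; apply: (epi_split (runitVK A)).
by rewrite -!runit_natural fg.
Qed.

Lemma lunit_tens A B : lunit (A ⊗ B) ∘ assoc I A B = lunit A ⊗₁ idm B.
Proof.
apply: tensI_inj.
apply: (epi_split (assocVK I (I ⊗ A) B)).
apply: (epi_split (i := assoc I I A ⊗₁ idm B)
  (tensm_inverse (assocVK I I A) (comp1m (idm B)))).
(* After tensoring with [I], both sides are compared by the pentagon on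
   [I, I, A, B] and the triangle. *)
rewrite -assoc_natural -[in RHS]compA tensm_comp_id triangle.
rewrite -tensm_id_comp -!compA (compA (idm I ⊗₁ assoc I A B)) -pentagon.
by rewrite compA triangle assoc_natural tensm1.
Qed.

Lemma lunit_runit_I : lunit (@I D) = runit I.
Proof.
apply: tensmI_inj; rewrite -lunit_tens -triangle; congr (_ ∘ _).
by apply: (mono_split (lunitK I)); rewrite lunit_natural.
Qed.

Lemma rev_assoc_natural A A' B B' X X' (f : hom A A') (g : hom B B')
    (h : hom X X') :
  assocV X' B' A' ∘ (h ⊗₁ (g ⊗₁ f)) = ((h ⊗₁ g) ⊗₁ f) ∘ assocV X B A.
Proof. by rewrite assocV_natural. Qed.

Lemma rev_pentagon A B X Y :
  assocV (Y ⊗ X) B A ∘ assocV Y X (B ⊗ A)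
  = (assocV Y X B ⊗₁ idm A) ∘ assocV Y (X ⊗ B) A ∘ (idm Y ⊗₁ assocV X B A).
Proof. by rewrite pentagonV compA. Qed.

Lemma pentagon_mixed A B X Y :
  (assoc A B X ⊗₁ idm Y) ∘ assocV (A ⊗ B) X Y
  = assocV A (B ⊗ X) Y ∘ (idm A ⊗₁ assocV B X Y) ∘ assoc A B (X ⊗ Y).
Proof.
apply: (epi_split (assocK A B (X ⊗ Y))).
rewrite -!compA pentagonV assocVK compm1 (precomp (tensm_comp_id _ _ _)).
by rewrite assocVK tensm1 comp1m.
Qed.

Lemma rev_triangle A B :
  (runit B ⊗₁ idm A) ∘ assocV B I A = idm B ⊗₁ lunit A.
Proof. by rewrite -triangle -compA assocVK compm1. Qed.

End Monoidal.

(** The monoidal category with the same morphisms and the tensor product taken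
    in the opposite order; it exchanges left and right duals. *)
Definition rev_monoidal (D : monoidal_category) : monoidal_category :=
  @MonoidalCategory D (@I D) (fun A B => @tens D B A)
    (fun _ _ _ _ f g => @tensm D _ _ _ _ g f)
    (fun A B => @tensm1 D B A)
    (fun _ _ _ _ _ _ f' f g' g => @tensmM D _ _ _ _ _ _ g' g f' f)
    (fun A B X => @assocV D X B A) (fun A B X => @assoc D X B A)
    (@runit D) (@runitV D) (@lunit D) (@lunitV D)
    (fun A B X => @assocVK D X B A) (fun A B X => @assocK D X B A)
    (@runitK D) (@runitVK D) (@lunitK D) (@lunitVK D)
    (fun _ _ _ _ _ _ f g h => rev_assoc_natural f g h)
    (fun _ _ f => runit_natural f) (fun _ _ f => lunit_natural f)
    (@rev_pentagon D) (@rev_triangle D).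

Lemma runit_tens (D : monoidal_category) (A B : D) :
  (idm A ⊗₁ runit B) ∘ assoc A B I = runit (A ⊗ B).
Proof.
have /= <- := @lunit_tens (rev_monoidal D) B A.
by rewrite -compA assocK compm1.
Qed.

(** * Dual pairs and transposition *)

Section DualPair.
Context (D : monoidal_category) (P Q : D) (ev : hom (P ⊗ Q) I)
  (co : hom I (Q ⊗ P)).

(** The transpose [X -> P] of a pairing of [X] with [Q], where [P] is meant to
    be left dual to [Q]; each of the two triangle identities makes one of the
    composites of transposition and evaluation the identity. *)
Definition transpose (X : D) (f : hom (X ⊗ Q) I) : hom X P :=
  lunit P ∘ (f ⊗₁ idm P) ∘ assocV X Q P ∘ (idm X ⊗₁ co) ∘ runitV X.

Lemma transposeK (X : D) (f : hom (X ⊗ Q) I) :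
  runit Q ∘ (idm Q ⊗₁ ev) ∘ assoc Q P Q ∘ (co ⊗₁ idm Q) ∘ lunitV Q = idm Q ->
  ev ∘ (transpose f ⊗₁ idm Q) = f.
Proof.
move=> tri.
rewrite /transpose -!tensm_comp_id -lunit_tens -!compA.
rewrite (precomp2 (assoc_natural _ _ _)) (precomp2 (esym (lunit_natural ev))).
rewrite tensm1 (precomp2 (tensm_swap f ev)) lunit_runit_I.
rewrite (precomp2 (runit_natural f)).
(* It remains to find the triangle identity, tensored with [X], after [f]. *)
have E := etrans (f_equal (tensm (idm X)) tri) (tensm1 X Q).
rewrite -[RHS]compm1 -[X in _ = _ ∘ X]E.
rewrite -!tensm_id_comp -!compA.
congr (_ ∘ _).
rewrite -runit_tens -compA; congr (_ ∘ _).
rewrite -tensm1 (precomp2 (assoc_natural _ _ _)).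
congr (_ ∘ _).
apply: (mono_split (i := assocV X Q (P ⊗ Q)) (assocVK _ _ _)).
rewrite (precomp (assocK _ _ _)) comp1m.
have -> : assoc (X ⊗ Q) P Q
  = assocV X Q (P ⊗ Q) ∘ (idm X ⊗₁ assoc Q P Q) ∘ assoc X (Q ⊗ P) Q
    ∘ (assoc X Q P ⊗₁ idm Q).
  rewrite -!compA (compA (idm X ⊗₁ _)) -pentagon.
  by rewrite (precomp (assocK _ _ _)) comp1m.
rewrite -!compA (precomp (tensm_comp_id _ _ _)) assocVK tensm1 comp1m.
rewrite (precomp2 (assoc_natural _ _ _)).
by rewrite -triangleV (precomp (assocVK _ _ _)) comp1m.
Qed.

Lemma transpose_ev (X : D) (g : hom X P) :
  lunit P ∘ (ev ⊗₁ idm P) ∘ assocV P Q P ∘ (idm P ⊗₁ co) ∘ runitV P = idm P ->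
  transpose (ev ∘ (g ⊗₁ idm Q)) = g.
Proof.
move=> tri.
rewrite /transpose -tensm_comp_id -!compA (precomp2 (assocV_natural _ _ _)).
rewrite tensm1 (precomp2 (esym (tensm_swap g co))) runitV_natural.
by rewrite !compA tri comp1m.
Qed.

End DualPair.

Section Left.
Context (D : autonomous_category).
Implicit Types A B X Y : D.

Lemma ldual_ext X A (f g : hom X (ldual A)) :
  evl A ∘ (f ⊗₁ idm A) = evl A ∘ (g ⊗₁ idm A) -> f = g.
Proof.
move=> fg.
rewrite -(transpose_ev f (ldual_triangle_dual A)) fg.
exact: transpose_ev (ldual_triangle_dual A).
Qed.

Lemma evr_ext X A (f g : hom X A) :
  evr A ∘ (f ⊗₁ idm (rdual A)) = evr A ∘ (g ⊗₁ idm (rdual A)) -> f = g.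
Proof.
move=> fg.
rewrite -(transpose_ev f (rdual_triangle A)) fg.
exact: transpose_ev (rdual_triangle A).
Qed.

(** The action of S on morphisms, the evaluation [e_{A,B}] and the canonical
    isomorphism [SS'A -> A] with its inverse.  These and several later
    definitions are locked, so that rewriting with associativity of composition
    does not unfold them; the lemmas [evl_map], [evl_star], [evl_canV] and
    [evr_can] characterize them by their pairings. *)
Definition lmap A B (f : hom A B) : hom (ldual B) (ldual A) :=
  locked (ldual_map f).

Definition lstar A B : hom (ldual (A ⊗ B) ⊗ A) (ldual B) :=
  locked (star_evl A B).

Definition can A : hom (ldual (rdual A)) A := locked (ldual_rdual A).

Definition canV A : hom A (ldual (rdual A)) := locked (ldual_rdualV A).

Lemma lmapE A B (f : hom A B) : lmap f = ldual_map f.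
Proof. by rewrite /lmap -lock. Qed.

Lemma lstarE A B : lstar A B = star_evl A B.
Proof. by rewrite /lstar -lock. Qed.

Lemma canE A : can A = ldual_rdual A.
Proof. by rewrite /can -lock. Qed.

Lemma canVE A : canV A = ldual_rdualV A.
Proof. by rewrite /canV -lock. Qed.

Lemma evl_map A B (f : hom A B) :
  evl A ∘ (lmap f ⊗₁ idm A) = evl B ∘ (idm (ldual B) ⊗₁ f).
Proof.
rewrite -[RHS](@transposeK _ _ _ _ _ _ _ (ldual_triangle A)) lmapE.
congr (_ ∘ (_ ⊗₁ _)); rewrite /ldual_map /transpose.
by rewrite -tensm_comp_id -!compA (precomp2 (assocV_natural _ _ _)).
Qed.

Lemma evl_star A B :
  evl B ∘ (lstar A B ⊗₁ idm B) = evl (A ⊗ B) ∘ assoc (ldual (A ⊗ B)) A B.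
Proof.
rewrite -[RHS](@transposeK _ _ _ _ _ _ _ (ldual_triangle B)) lstarE.
congr (_ ∘ (_ ⊗₁ _)); rewrite /star_evl /transpose.
rewrite -tensm_comp_id -!compA; congr (_ ∘ (_ ∘ _)).
by rewrite (precomp (pentagon_mixed _ _ _ _)) -!compA.
Qed.

Lemma evl_canV A : evl (rdual A) ∘ (canV A ⊗₁ idm (rdual A)) = evr A.
Proof. by rewrite canVE; apply: transposeK (ldual_triangle (rdual A)). Qed.

Lemma evr_can A : evr A ∘ (can A ⊗₁ idm (rdual A)) = evl (rdual A).
Proof. by rewrite canE; apply: transposeK (rdual_triangle_dual A). Qed.

Lemma lmap_comp A B X (g : hom B X) (f : hom A B) :
  lmap (g ∘ f) = lmap f ∘ lmap g.
Proof.
apply: ldual_ext.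
rewrite evl_map -tensm_comp_id compA evl_map -compA tensm_swap.
by rewrite compA evl_map -compA tensm_id_comp.
Qed.

Lemma lmap1 A : lmap (idm A) = idm (ldual A).
Proof. by apply: ldual_ext; rewrite evl_map. Qed.

Lemma canK A : canV A ∘ can A = idm _.
Proof.
by apply: ldual_ext; rewrite -tensm_comp_id compA evl_canV
  evr_can tensm1 compm1.
Qed.

Lemma canVK A : can A ∘ canV A = idm _.
Proof.
by apply: evr_ext; rewrite -tensm_comp_id compA evr_can
  evl_canV tensm1 compm1.
Qed.

Lemma lstar_dinatural A A' B B' (f : hom A A') (g : hom B B') :
  lmap g ∘ lstar A' B' ∘ (idm _ ⊗₁ f)
  = lstar A B ∘ (lmap (f ⊗₁ g) ⊗₁ idm A).
Proof.
apply: ldual_ext.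
rewrite -!tensm_comp_id !compA evl_map evl_star -(compA _ (_ ⊗₁ g)) tensm_swap.
rewrite compA evl_star -!compA tensm_rl !assoc_natural tensm1.
by rewrite (precomp (evl_map _)) -!compA.
Qed.

(** Naturality of [can]; the hypothesis says that [g] is [S'f], given by its
    pairing because S' on morphisms is obtained from S by reversing the tensor
    product. *)
Lemma can_natural A B (f : hom A B) (g : hom (rdual B) (rdual A)) :
  evr A ∘ (idm A ⊗₁ g) = evr B ∘ (f ⊗₁ idm (rdual B)) ->
  can B ∘ lmap g = f ∘ can A.
Proof.
move=> Hg; apply: evr_ext; rewrite -!tensm_comp_id !compA evr_can evl_map.
by rewrite -Hg -compA tensm_swap compA evr_can.
Qed.

End Left.

(** * Reversing the tensor product *)

(** The autonomous category with the reversed tensor product: its left duals are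
    the right duals of [D], and conversely. *)
Definition rev_autonomous (D : autonomous_category) : autonomous_category :=
  @AutonomousCategory (rev_monoidal D)
    (@rdual D) (@evr D) (@coevr D) (@ldual D) (@evl D) (@coevl D)
    (@rdual_triangle D) (@rdual_triangle_dual D)
    (@ldual_triangle D) (@ldual_triangle_dual D).

Section Reverse.
Context (D : autonomous_category).
Implicit Types A B X Y : D.

Lemma rev_ldual_map A B (f : hom A B) :
  @ldual_map (rev_autonomous D) A B f = rdual_map f.
Proof.
rewrite /ldual_map /rdual_map /= -!compA; congr (_ ∘ (_ ∘ _)).
by rewrite (precomp2 (assoc_natural _ _ _)).
Qed.

Lemma rev_star_evl A B :
  @star_evl (rev_autonomous D) A B = star_evr A B.
Proof.
rewrite /star_evl /star_evr /= -!compA; congr (_ ∘ (_ ∘ _)).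
rewrite !compA; congr (_ ∘ _ ∘ _).
rewrite -compA.
apply: (mono_split (i := idm (rdual B) ⊗₁ assoc B A (rdual (B ⊗ A)))
  (tensm_inverse (comp1m _) (assocK _ _ _))).
rewrite !compA -pentagon tensm_inverse ?comp1m ?assocVK //.
by rewrite -compA assocVK compm1.
Qed.

Lemma op_ldual_map A B (f : hom A B) :
  @ldual_map (op_autonomous D) B A f = rdual_map f.
Proof. by rewrite /ldual_map /rdual_map /= -!compA. Qed.

Lemma op_rdual_map A B (f : hom A B) :
  @rdual_map (op_autonomous D) B A f = ldual_map f.
Proof. by rewrite /ldual_map /rdual_map /= -!compA. Qed.

End Reverse.

(** The action of S' on morphisms and the evaluation [e'_{B,A}], as the left
    notions for the reversed tensor product. *)
Definition rmap (D : autonomous_category) (A B : D) (f : hom A B) :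
  hom (rdual B) (rdual A) := @lmap (rev_autonomous D) A B f.

Definition rstar (D : autonomous_category) (B A : D) :
  hom (B ⊗ rdual (A ⊗ B)) (rdual A) := @lstar (rev_autonomous D) B A.

Section Right.
Context (D : autonomous_category).
Implicit Types A B X Y : D.

Lemma rmapE A B (f : hom A B) : rmap f = rdual_map f.
Proof. by rewrite /rmap lmapE rev_ldual_map. Qed.

Lemma evr_map A B (f : hom A B) :
  evr A ∘ (idm A ⊗₁ rmap f) = evr B ∘ (f ⊗₁ idm (rdual B)).
Proof. exact: (@evl_map (rev_autonomous D)). Qed.

Lemma evr_star A B :
  evr A ∘ (idm A ⊗₁ rstar B A) = evr (A ⊗ B) ∘ assocV A B (rdual (A ⊗ B)).
Proof. exact: (@evl_star (rev_autonomous D)). Qed.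

Lemma rdual_ext X A (f g : hom X (rdual A)) :
  evr A ∘ (idm A ⊗₁ f) = evr A ∘ (idm A ⊗₁ g) -> f = g.
Proof. exact: (@ldual_ext (rev_autonomous D)). Qed.

End Right.

(** This is [evl_map] for the opposite category with reversed tensor product,
    where the left duals are again those of [D] and [coevl] is the evaluation. *)
Lemma coevl_map (D : autonomous_category) (A B : D) (f : hom A B) :
  (f ⊗₁ idm (ldual A)) ∘ coevl A = (idm B ⊗₁ lmap f) ∘ coevl B.
Proof.
rewrite lmapE -op_rdual_map -rmapE.
exact: esym (@evl_map (rev_autonomous (op_autonomous D)) B A f).
Qed.

(** * Coalgebras of a comonad *)

(** Eilenberg-Moore coalgebras, with underlying object [car] and coaction
    [str]. *)
Record coalgebra (C : category) (G : comonad C) := Coalgebra {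
  car :> C;
  str : hom car (G car);
  str_counit : counit G car ∘ str = idm car;
  str_comult : comult G car ∘ str = fmap G str ∘ str
}.
Arguments str {C G} A : rename.

(** The morphism [f] of underlying objects is a morphism of coalgebras. *)
Definition is_cmap (C : category) (G : comonad C) (A B : coalgebra G)
  (f : hom A B) : Prop := fmap G f ∘ str A = str B ∘ f.

Section Coalgebras.
Context (C : category) (G : comonad C).
Implicit Types (A B E : coalgebra G) (X Y : C).

Lemma cmap_comp A B E (g : hom B E) (f : hom A B) :
  is_cmap g -> is_cmap f -> is_cmap (A := A) (B := E) (g ∘ f).
Proof. by move=> Hg Hf; rewrite /is_cmap fmapM -compA Hf compA Hg compA. Qed.

Lemma cmap_inv A B (f : hom A B) (g : hom B A) :
  f ∘ g = idm _ -> g ∘ f = idm _ -> is_cmap f -> is_cmap (A := B) (B := A) g.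
Proof.
move=> fg gf Hf; apply: (mono_split (i := fmap G f) (fmap_inverse G gf)).
by rewrite !compA -fmapM fg fmap1 comp1m Hf -compA fg compm1.
Qed.

(** The cofree coalgebra on an object. *)
Definition cofree X : coalgebra G :=
  Coalgebra (comult_counitl G X) (comult_coassoc G X).

Section Transport.
Context (A : coalgebra G) (X : C) (i : hom A X) (iV : hom X A).
Hypotheses (iK : iV ∘ i = idm _) (iVK : i ∘ iV = idm _).

Lemma transport_counit : counit G X ∘ (fmap G i ∘ str A ∘ iV) = idm X.
Proof.
by rewrite !compA -counit_natural -(compA i) str_counit compm1.
Qed.

Lemma transport_comult :
  comult G X ∘ (fmap G i ∘ str A ∘ iV)
  = fmap G (fmap G i ∘ str A ∘ iV) ∘ (fmap G i ∘ str A ∘ iV).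
Proof.
rewrite !compA -comult_natural -(compA _ (comult G A)) str_comult !fmapM -!compA.
by rewrite (compA (fmap G iV)) -fmapM iK fmap1 comp1m.
Qed.

(** The coalgebra structure carried along an isomorphism [i : A -> X]. *)
Definition transport : coalgebra G := Coalgebra transport_counit transport_comult.

Lemma cmap_transport : is_cmap (A := A) (B := transport) i.
Proof. by rewrite /is_cmap /= -!compA iK compm1. Qed.

End Transport.
End Coalgebras.

Section Monoidal_comonad.
Context (D : monoidal_category) (G : monoidal_comonad D).
Implicit Types A B E : coalgebra G.

Lemma tens_counit A B :
  counit G (A ⊗ B) ∘ (phi G A B ∘ (str A ⊗₁ str B)) = idm (A ⊗ B).
Proof. by rewrite compA counit_phi -tensmM !str_counit tensm1. Qed.

Lemma tens_comult A B :
  comult G (A ⊗ B) ∘ (phi G A B ∘ (str A ⊗₁ str B))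
  = fmap G (phi G A B ∘ (str A ⊗₁ str B)) ∘ (phi G A B ∘ (str A ⊗₁ str B)).
Proof.
rewrite compA comult_phi -!compA -tensmM !str_comult tensmM fmapM -!compA.
by rewrite (precomp2 (phi_natural _ _ _)).
Qed.

(** The tensor product of coalgebras and the unit coalgebra. *)
Definition ctens A B : coalgebra G :=
  Coalgebra (tens_counit A B) (tens_comult A B).

Definition cunit : coalgebra G := Coalgebra (counit_phi0 G) (comult_phi0 G).

Lemma cmap_id A : is_cmap (A := A) (B := A) (idm A).
Proof. by rewrite /is_cmap fmap1 comp1m compm1. Qed.

Lemma cmap_tens A A' B B' (f : hom A A') (g : hom B B') :
  is_cmap f -> is_cmap g ->
  is_cmap (A := ctens A B) (B := ctens A' B') (f ⊗₁ g).
Proof.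
move=> Hf Hg; rewrite /is_cmap /= compA phi_natural -!compA -!tensmM.
by rewrite Hf Hg.
Qed.

Lemma cmap_assoc A B E :
  is_cmap (A := ctens (ctens A B) E) (B := ctens A (ctens B E)) (assoc A B E).
Proof.
rewrite /is_cmap /= -[X in _ ∘ (_ ∘ (_ ⊗₁ X))]comp1m.
rewrite -[X in _ = _ ∘ (X ⊗₁ _) ∘ _]comp1m.
by rewrite !tensmM !compA phi_assoc -!compA assoc_natural.
Qed.

Lemma cmap_lunit A : is_cmap (A := ctens cunit A) (B := A) (lunit A).
Proof.
rewrite /is_cmap /= -[X in X ⊗₁ _]compm1 -[X in _ ⊗₁ X]comp1m tensmM !compA.
by rewrite phi_lunit lunit_natural.
Qed.

End Monoidal_comonad.

Section ReverseComonad.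
Context (D : monoidal_category) (G : monoidal_comonad D).

Lemma rev_phi_assoc A B E :
  fmap G (assocV E B A) ∘ phi G E (B ⊗ A) ∘ (idm (G E) ⊗₁ phi G B A)
  = phi G (E ⊗ B) A ∘ (phi G E B ⊗₁ idm (G A)) ∘ assocV (G E) (G B) (G A).
Proof.
rewrite -compA; symmetry.
apply: (iso_square (assocVK _ _ _) (fmap_inverse G (assocK E B A))).
by rewrite !compA phi_assoc.
Qed.

(** The same comonad on the category with reversed tensor product. *)
Definition rev_comonad : monoidal_comonad (rev_monoidal D) :=
  @MonoidalComonad (rev_monoidal D) G (fun A B => phi G B A) (phi0 G)
    (fun _ _ _ _ f g => phi_natural G g f) rev_phi_assoc
    (phi_runit G) (phi_lunit G)
    (fun A B => comult_phi G B A) (comult_phi0 G)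
    (fun A B => counit_phi G B A) (counit_phi0 G).

End ReverseComonad.

Section ReverseStar.
Context (D : autonomous_category) (G : monoidal_comonad D)
  (st : star_structure G).
Let rG : monoidal_comonad (rev_autonomous D) := rev_comonad G.

Lemma rev_rdual_map (A B : D) (f : hom A B) :
  @rdual_map (rev_autonomous D) A B f = ldual_map f.
Proof. exact: esym (@rev_ldual_map (rev_autonomous D) A B f). Qed.

Lemma rev_star_evr (A B : D) :
  @star_evr (rev_autonomous D) A B = star_evl A B.
Proof. exact: esym (@rev_star_evl (rev_autonomous D) A B). Qed.

(** The star structure on the reversed category, with [nu] and [nu']
    exchanged. *)
Definition rev_star : star_structure rG.
Proof.
refine (@StarStructure (rev_autonomous D) rG (nu' st) (nu st) _ _ _ _ _ _ _ _ _ _).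
- by move=> A B f; rewrite !rev_ldual_map; apply: nu'_natural.
- by move=> A B f; rewrite !rev_rdual_map; apply: nu_natural.
- by move=> A; rewrite !rev_ldual_map; apply: counit_nu'.
- by move=> A; rewrite !rev_ldual_map; apply: comult_nu'.
- by move=> A; rewrite !rev_rdual_map; apply: counit_nu.
- by move=> A; rewrite !rev_rdual_map; apply: comult_nu.
- by move=> A; rewrite !rev_ldual_map; apply: nu'_nu.
- by move=> A; rewrite !rev_rdual_map; apply: nu_nu'.
- by move=> A B; rewrite !rev_ldual_map !rev_star_evl; apply: nu'_star_evr.
- by move=> A B; rewrite !rev_rdual_map !rev_star_evr; apply: nu_star_evl.
Defined.

End ReverseStar.

(** * Duals of coalgebras over a star-autonomous comonad *)

Section StarCoalgebras.
Context (D : autonomous_category) (G : monoidal_comonad D)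
  (st : star_structure G).
Implicit Types A B E : coalgebra G.

Lemma nu_lmap (X Y : D) (f : hom X Y) :
  fmap G (lmap (fmap G f)) ∘ nu st Y = nu st X ∘ lmap f.
Proof. by rewrite !lmapE; apply: nu_natural. Qed.

Lemma ldual_counit A :
  counit G (ldual A) ∘ (fmap G (lmap (str A)) ∘ nu st A) = idm (ldual A).
Proof.
rewrite compA -counit_natural -compA counit_nu -lmapE -lmap_comp str_counit.
exact: lmap1.
Qed.

Lemma ldual_comult A :
  comult G (ldual A) ∘ (fmap G (lmap (str A)) ∘ nu st A)
  = fmap G (fmap G (lmap (str A)) ∘ nu st A)
    ∘ (fmap G (lmap (str A)) ∘ nu st A).
Proof.
rewrite compA -comult_natural -compA comult_nu -lmapE !compA -!fmapM -lmap_comp.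
rewrite str_comult lmap_comp (fmapM G (lmap (str A))) -(compA (fmap G (lmap (str A)))) nu_lmap.
by rewrite !fmapM -!compA.
Qed.

(** The coalgebra [SA], with coaction [G(S a) ∘ nu_A] for [a] the coaction
    of [A]. *)
Definition cldual A : coalgebra G := Coalgebra (ldual_counit A) (ldual_comult A).

Lemma cmap_lmap A B (f : hom A B) :
  is_cmap f -> is_cmap (A := cldual B) (B := cldual A) (lmap f).
Proof.
move=> Hf; rewrite /is_cmap /= compA -fmapM -lmap_comp -Hf lmap_comp fmapM -!compA.
by rewrite nu_lmap.
Qed.

(** This is [nu_star_evl], precomposed with the coaction of [A] and postcomposed
    with the dual of that of [B]. *)
Lemma cmap_lstar A B :
  is_cmap (A := ctens (cldual (ctens A B)) A) (B := cldual B) (lstar A B).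
Proof.
(* The precomposition turns [counit] into the identity and [comult] into
   [fmap G (str A) ∘ str A]. *)
have E := f_equal (fun u => u ∘ (idm _ ⊗₁ str A)) (nu_star_evl st A B).
rewrite -!lmapE -!lstarE -!compA tensm_id_comp str_counit tensm1 compm1 in E.
rewrite -tensmM str_comult compm1 in E.
rewrite /is_cmap /= -(compA _ (nu st B)) E.
have -> : (fmap G (lmap (phi G A B ∘ (str A ⊗₁ str B))) ∘ nu st (A ⊗ B)) ⊗₁ str A
  = (fmap G (lmap (phi G A B ∘ (str A ⊗₁ str B))) ⊗₁ fmap G (idm A))
    ∘ (nu st (A ⊗ B) ⊗₁ str A).
  by rewrite -tensmM fmap1 comp1m.
have -> : nu st (A ⊗ B) ⊗₁ (fmap G (str A) ∘ str A)
  = (fmap G (idm _) ⊗₁ fmap G (str A)) ∘ (nu st (A ⊗ B) ⊗₁ str A).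
  by rewrite -tensmM fmap1 comp1m.
rewrite (precomp2 (esym (phi_natural _ _ _))) (precomp2 (esym (phi_natural _ _ _))).
rewrite !compA -!fmapM; congr (fmap G _ ∘ _ ∘ _).
rewrite lmap_comp -tensm_comp_id (compA (lstar A B)) -lstar_dinatural -!compA.
by rewrite tensm_rl tensm_lr.
Qed.

End StarCoalgebras.

(** * The antipode and the evaluation *)

Section Hopf.
Context (D : autonomous_category) (G : monoidal_comonad D)
  (st : star_structure G).
Implicit Types A B E : coalgebra G.
Implicit Types X Y : D.
Local Notation ldualc := (cldual st).

(** The coalgebra [S'A], with coaction [G(S' a) ∘ nu'_A]. *)
Definition crdual A : coalgebra G :=
  @cldual (rev_autonomous D) (rev_comonad G) (rev_star st) A.

Lemma cmap_rmap A B (f : hom A B) :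
  is_cmap f -> is_cmap (A := crdual B) (B := crdual A) (rmap f).
Proof. exact: (@cmap_lmap _ _ (rev_star st) A B f). Qed.

Lemma cmap_rstar B A :
  is_cmap (A := ctens B (crdual (ctens A B))) (B := crdual A) (rstar B A).
Proof. exact: (@cmap_lstar _ _ (rev_star st) B A). Qed.

(** This is [nu_nu'], with [str A] moved across [can] by naturality. *)
Lemma cmap_canV A : is_cmap (A := A) (B := ldualc (crdual A)) (canV A).
Proof.
rewrite /is_cmap /= lmap_comp fmapM -(compA _ _ (nu st _)) nu_lmap compA.
have := nu_nu' st A; rewrite -lmapE -canVE -canE => ->.
rewrite -!compA (precomp (can_natural (evr_map (str A)))) -!compA canVK.
by rewrite compm1.
Qed.

Lemma cmap_can A : is_cmap (A := ldualc (crdual A)) (B := A) (can A).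
Proof.
exact: (@cmap_inv _ _ A (ldualc (crdual A)) (canV A) (can A)
  (canK A) (canVK A) (cmap_canV A)).
Qed.

Lemma cmap_runit A : is_cmap (A := ctens A (cunit G)) (B := A) (runit A).
Proof. exact: (@cmap_lunit (rev_monoidal D) (rev_comonad G) A). Qed.

(** The dualizing coalgebra [S'I].  Its underlying object is isomorphic to [I],
    but under this isomorphism its coaction need not be [phi0]. *)
Definition bot : coalgebra G := crdual (cunit G).

(** The isomorphism of [S'I] with [I] in [D], and its inverse; in general they
    are not coalgebra morphisms. *)
Definition bot_unit : hom (rdual (@I D)) I :=
  locked (evr I ∘ lunitV (rdual I)).

Definition unit_bot : hom (@I D) (rdual I) :=
  @transpose (rev_monoidal D) (rdual I) I (coevr I) I (runit (@I D)).

Lemma evr_I : evr I = bot_unit ∘ lunit (rdual I).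
Proof. by rewrite /bot_unit -lock -compA lunitK compm1. Qed.

Lemma unit_botK : bot_unit ∘ unit_bot = idm (@I D).
Proof.
have E : evr I ∘ (idm I ⊗₁ unit_bot) = runit I.
  exact: (@transposeK (rev_monoidal D) (rdual I) I (evr I)
    (coevr I) I (runit (@I D)) (rdual_triangle I)).
rewrite /bot_unit -lock -compA -lunitV_natural compA E.
by rewrite -lunit_runit_I lunitVK.
Qed.

Lemma bot_unitK : unit_bot ∘ bot_unit = idm (rdual (@I D)).
Proof.
apply: rdual_ext; rewrite evr_I -2!(compA bot_unit) !lunit_natural.
by rewrite -(compA unit_bot) (precomp unit_botK) !comp1m.
Qed.

(** The isomorphism of [X ⊗ S'I] with [X], and its inverse. *)
Definition bot_runit X : hom (X ⊗ rdual I) X :=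
  locked (runit X ∘ (idm X ⊗₁ bot_unit)).

Definition bot_runitV X : hom X (X ⊗ rdual I) :=
  locked ((idm X ⊗₁ unit_bot) ∘ runitV X).

Lemma bot_runitK X : bot_runitV X ∘ bot_runit X = idm _.
Proof.
rewrite /bot_runit /bot_runitV -!lock -compA (precomp (runitK X)) comp1m.
by rewrite tensm_id_comp bot_unitK tensm1.
Qed.

Lemma bot_runitVK X : bot_runit X ∘ bot_runitV X = idm _.
Proof.
rewrite /bot_runit /bot_runitV -!lock -compA (precomp (tensm_id_comp _ _ _)).
by rewrite unit_botK tensm1 comp1m runitVK.
Qed.

Lemma bot_runit_natural X Y (f : hom X Y) :
  bot_runit Y ∘ (f ⊗₁ idm _) = f ∘ bot_runit X.
Proof.
by rewrite /bot_runit -!lock -compA tensm_swap compA runit_natural compA.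
Qed.

Lemma bot_runit_tens X Y :
  (idm X ⊗₁ bot_runit Y) ∘ assoc X Y (rdual I) = bot_runit (X ⊗ Y).
Proof.
rewrite /bot_runit -!lock -tensm_id_comp -compA -assoc_natural tensm1 compA.
by rewrite runit_tens.
Qed.

Lemma evr_bot_runit : evr (@I D) = bot_runit I.
Proof.
by rewrite /bot_runit -lock -lunit_runit_I lunit_natural evr_I.
Qed.

Lemma bot_runitV_natural X Y (f : hom X Y) :
  (f ⊗₁ idm _) ∘ bot_runitV X = bot_runitV Y ∘ f.
Proof.
exact: iso_square (bot_runitVK X) (bot_runitK Y) (bot_runit_natural f).
Qed.

(** The coalgebra [A ⊗ bot], carried to the object [A]. *)
Definition ctwist A : coalgebra G :=
  @transport _ _ (ctens A bot) A (bot_runit A) (bot_runitV A)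
    (bot_runitK A) (bot_runitVK A).

(** Multiplication on the right by the coaction of [bot]; it is natural, and
    [ctwist A] has coaction [twist A ∘ str A]. *)
Definition twist X : hom (G X) (G X) :=
  fmap G (bot_runit X) ∘ phi G X (rdual I) ∘ (idm (G X) ⊗₁ str bot)
    ∘ bot_runitV (G X).

Lemma twist_natural X Y (f : hom X Y) :
  twist Y ∘ fmap G f = fmap G f ∘ twist X.
Proof.
rewrite /twist -!compA -bot_runitV_natural (precomp2 (tensm_swap _ _)).
rewrite -[idm (G (rdual I))]fmap1 (precomp2 (esym (phi_natural _ _ _))).
by rewrite !compA -!fmapM bot_runit_natural.
Qed.

Lemma str_ctwist A : str (ctwist A) = twist A ∘ str A.
Proof.
rewrite /= /twist -!compA -bot_runitV_natural; congr (_ ∘ (_ ∘ _)).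
by rewrite compA tensm_rl.
Qed.

(** The antipode of the comonad: [nu] corrected by [twist]. *)
Definition antipode X : hom (ldual X) (G (ldual (G X))) :=
  fmap G (lmap (twist X)) ∘ nu st X.

Lemma antipode_natural X Y (f : hom X Y) :
  fmap G (lmap (fmap G f)) ∘ antipode Y = antipode X ∘ lmap f.
Proof.
rewrite /antipode -compA -nu_lmap !compA -!fmapM -!lmap_comp.
by rewrite twist_natural.
Qed.

(** The coalgebra [S(A ⊗ bot)], carried to the object [SA]. *)
Definition ldualT A : coalgebra G := ldualc (ctwist A).

Lemma str_ldualT A : str (ldualT A) = fmap G (lmap (str A)) ∘ antipode A.
Proof.
by rewrite /ldualT /antipode compA -fmapM -lmap_comp -str_ctwist.
Qed.

(** The evaluation is the composite of the coalgebra morphisms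
    [S(A ⊗ bot) ⊗ A -> S(bot)] and [S(bot) = SS'I -> I]. *)
Lemma cmap_evl A : is_cmap (A := ctens (ldualT A) A) (B := cunit G) (evl A).
Proof.
have <- : can I ∘ (lstar A (rdual I) ∘ (lmap (bot_runit A) ⊗₁ idm A)) = evl A.
  apply: evr_ext.
  rewrite -!tensm_comp_id compA evr_can compA evl_star.
  rewrite -compA assoc_natural tensm1 compA evl_map -compA bot_runit_tens evr_bot_runit.
  by rewrite bot_runit_natural.
apply: (@cmap_comp _ _ _ (ldualc bot) _ _ _ (cmap_can (cunit G))).
apply: (@cmap_comp _ _ _ (ctens (ldualc (ctens A bot)) A) _ _ _
  (cmap_lstar st A bot)).
apply: (@cmap_tens _ _ _ (ldualc (ctens A bot)) _ A); last exact: cmap_id.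
by apply: (@cmap_lmap _ _ st (ctens A bot) (ctwist A)); apply: cmap_transport.
Qed.

(** * The coevaluation *)

Lemma cmap_lunitV A : is_cmap (A := A) (B := ctens (cunit G) A) (lunitV A).
Proof.
exact: (@cmap_inv _ _ (ctens (cunit G) A) A (lunit A) (lunitV A)
  (lunitVK A) (lunitK A) (cmap_lunit A)).
Qed.

Lemma cmap_assocV A B E :
  is_cmap (A := ctens A (ctens B E)) (B := ctens (ctens A B) E) (assocV A B E).
Proof.
exact: (@cmap_inv _ _ (ctens (ctens A B) E) (ctens A (ctens B E))
  (assoc A B E) (assocV A B E)
  (assocVK A B E) (assocK A B E) (cmap_assoc A B E)).
Qed.

(** The transpose [Y -> SZ] of a pairing [f : Y ⊗ Z -> S'I], written so that it
    is a coalgebra morphism when [f] is one: it is the composite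
    [Y -> SS'I ⊗ Y -> S(Y ⊗ Z) ⊗ Y -> SZ]. *)
Definition bot_transpose (Y Z : D) (f : hom (Y ⊗ Z) (rdual I)) :
  hom Y (ldual Z) :=
  locked (lstar Y Z ∘ ((lmap f ∘ canV I) ⊗₁ idm Y) ∘ lunitV Y).

(** The morphism [I -> SS'I -> SX] dual to [f] has [f] as its pairing. *)
Lemma evl_canV_I X (f : hom X (rdual I)) :
  evl X ∘ ((lmap f ∘ canV I) ⊗₁ idm X) = bot_unit ∘ f ∘ lunit X.
Proof.
rewrite -tensm_comp_id compA evl_map -compA tensm_swap compA evl_canV evr_I.
by rewrite -compA lunit_natural compA.
Qed.

Lemma evl_bot_transpose (Y Z : D) (f : hom (Y ⊗ Z) (rdual I)) :
  evl Z ∘ (bot_transpose f ⊗₁ idm Z) = bot_unit ∘ f.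
Proof.
rewrite /bot_transpose -lock -2!tensm_comp_id !compA evl_star.
rewrite -(compA (evl _)) assoc_natural tensm1 compA evl_canV_I.
rewrite -2!compA (compA (lunit _)) lunit_tens tensm_comp_id lunitVK tensm1.
by rewrite compm1.
Qed.

Lemma cmap_bot_transpose A B (f : hom (A ⊗ B) (rdual I)) :
  is_cmap (A := ctens A B) (B := bot) f ->
  is_cmap (A := A) (B := ldualc B) (bot_transpose f).
Proof.
move=> Hf; rewrite /bot_transpose -lock.
apply: (@cmap_comp _ _ _ (ctens (cunit G) A) _ _ _ _ (cmap_lunitV A)).
apply: (@cmap_comp _ _ _ (ctens (ldualc (ctens A B)) A) _ _ _
  (cmap_lstar st A B)).
apply: (@cmap_tens _ _ _ (ldualc (ctens A B)) _ A); last exact: cmap_id.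
apply: (@cmap_comp _ _ _ (ldualc bot) _ _ _ _ (cmap_canV (cunit G))).
exact: (@cmap_lmap _ _ st (ctens A B) bot).
Qed.

(** The evaluation [X ⊗ S'X -> I] as a morphism to [S'I], through which it is a
    coalgebra morphism. *)
Definition rpair X : hom (X ⊗ rdual X) (rdual I) :=
  locked (rstar X I ∘ (idm X ⊗₁ rmap (lunit X))).

Lemma bot_unit_rpair X : bot_unit ∘ rpair X = evr X.
Proof.
apply: (epi_split (lunitVK _)).
rewrite -compA -lunit_natural compA -evr_I /rpair -lock -tensm_id_comp compA.
rewrite evr_star -compA -assocV_natural tensm1 compA evr_map -compA.
by rewrite -lunit_tens -compA assocVK compm1.
Qed.

Lemma cmap_rpair A : is_cmap (A := ctens A (crdual A)) (B := bot) (rpair A).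
Proof.
rewrite /rpair -lock.
apply: (@cmap_comp _ _ _ (ctens A (crdual (ctens (cunit G) A))) _ _ _
  (cmap_rstar A (cunit G))).
apply: (@cmap_tens _ _ A _ _ _ (idm A)); first exact: cmap_id.
exact: (@cmap_rmap (ctens (cunit G) A) A _ (cmap_lunit A)).
Qed.

(** The contraction [X ⊗ SX ⊗ X -> X] of the last two factors. *)
Definition contract X : hom ((X ⊗ ldual X) ⊗ X) X :=
  locked (runit X ∘ (idm X ⊗₁ evl X) ∘ assoc X (ldual X) X).

Lemma contract_coevl X : contract X ∘ (coevl X ⊗₁ idm X) = lunit X.
Proof.
apply: (epi_split (lunitK X)).
by rewrite lunitVK /contract -lock ldual_triangle.
Qed.

Lemma contract_triangle X :
  (contract X ⊗₁ idm (ldual X)) ∘ assocV (X ⊗ ldual X) X (ldual X)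
    ∘ (idm (X ⊗ ldual X) ⊗₁ coevl X) ∘ runitV (X ⊗ ldual X) = idm _.
Proof.
rewrite /contract -lock -2!tensm_comp_id -!compA.
rewrite (precomp (pentagon_mixed _ _ _ _)) -!compA (precomp2 (assocV_natural _ _ _)) (precomp (rev_triangle _ _)).
rewrite -tensm1 (precomp2 (assoc_natural _ _ _)).
have -> : assoc X (ldual X) I ∘ runitV (X ⊗ ldual X) = idm X ⊗₁ runitV (ldual X).
  apply: (mono_split (i := idm X ⊗₁ runit (ldual X))
    (tensm_inverse (comp1m _) (runitK _))).
  by rewrite compA runit_tens runitVK tensm_inverse ?comp1m ?runitVK.
by rewrite !tensm_id_comp !compA ldual_triangle_dual.
Qed.

Lemma cmap_contract A :
  is_cmap (A := ctens (ctens A (ldualT A)) A) (B := A) (contract A).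
Proof.
rewrite /contract -lock.
apply: (@cmap_comp _ _ _ (ctens A (ctens (ldualT A) A)) _ _ _ _
  (cmap_assoc A (ldualT A) A)).
apply: (@cmap_comp _ _ _ (ctens A (cunit G)) _ _ _ (cmap_runit A)).
apply: (@cmap_tens _ _ A _ (ctens (ldualT A) A) _ (idm A)); first exact: cmap_id.
exact: cmap_evl.
Qed.

(** The pairing of [X ⊗ SX] with [X ⊗ S'X], valued in [S'I]. *)
Definition double_pair X :
  hom ((X ⊗ ldual X) ⊗ (X ⊗ rdual X)) (rdual I) :=
  locked (rpair X ∘ (contract X ⊗₁ idm (rdual X))
    ∘ assocV (X ⊗ ldual X) X (rdual X)).

Lemma cmap_double_pair A :
  is_cmap (A := ctens (ctens A (ldualT A)) (ctens A (crdual A))) (B := bot)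
    (double_pair A).
Proof.
rewrite /double_pair -lock.
apply: (@cmap_comp _ _ _ (ctens (ctens (ctens A (ldualT A)) A) (crdual A))
  _ _ _ _ (cmap_assocV (ctens A (ldualT A)) A (crdual A))).
apply: (@cmap_comp _ _ _ (ctens A (crdual A)) _ _ _ (cmap_rpair A)).
apply: (@cmap_tens _ _ (ctens (ctens A (ldualT A)) A) _ (crdual A)).
  exact: cmap_contract.
exact: cmap_id.
Qed.

Lemma bot_unit_double_pair X :
  bot_unit ∘ double_pair X
  = evr X ∘ (contract X ⊗₁ idm (rdual X)) ∘ assocV (X ⊗ ldual X) X (rdual X).
Proof. by rewrite /double_pair -lock !compA bot_unit_rpair. Qed.

(** The composite
    [S(X ⊗ S'X) -> S(X ⊗ S'X) ⊗ X ⊗ SX -> SS'X ⊗ SX -> X ⊗ SX], a retraction in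
    [D] of the transpose of [double_pair]. *)
Definition retract X : hom (ldual (X ⊗ rdual X)) (X ⊗ ldual X) :=
  locked (((can X ∘ lstar X (rdual X)) ⊗₁ idm (ldual X))
    ∘ assocV (ldual (X ⊗ rdual X)) X (ldual X)
    ∘ (idm (ldual (X ⊗ rdual X)) ⊗₁ coevl X) ∘ runitV (ldual (X ⊗ rdual X))).

Lemma can_star_transpose X :
  can X ∘ lstar X (rdual X) ∘ (bot_transpose (double_pair X) ⊗₁ idm X)
  = contract X.
Proof.
apply: evr_ext; rewrite -2!tensm_comp_id !compA evr_can evl_star -compA.
rewrite assoc_natural tensm1 compA evl_bot_transpose bot_unit_double_pair -compA.
by rewrite assocK compm1.
Qed.

Lemma retractK X : retract X ∘ bot_transpose (double_pair X) = idm (X ⊗ ldual X).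
Proof.
rewrite /retract -lock -!compA -runitV_natural (precomp2 (tensm_swap _ _)).
rewrite -tensm1 (precomp2 (esym (assocV_natural _ _ _))).
rewrite (precomp (tensm_comp_id _ _ _)).
by rewrite can_star_transpose tensm1 !compA contract_triangle.
Qed.

Lemma bot_transpose_coevl X :
  bot_transpose (double_pair X) ∘ coevl X = lmap (rpair X) ∘ canV I.
Proof.
apply: ldual_ext; rewrite evl_canV_I bot_unit_rpair -tensm_comp_id compA.
rewrite evl_bot_transpose bot_unit_double_pair -compA -tensm1.
rewrite -assocV_natural -compA (precomp (tensm_comp_id _ _ _)) contract_coevl.
by rewrite -lunit_tens -(compA (lunit _)) assocVK compm1.
Qed.

(** Both [bot_transpose (double_pair A)] and its composite with [coevl A] are
    coalgebra morphisms, and the former is split mono in [D]. *)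
Lemma cmap_coevl A : is_cmap (A := cunit G) (B := ctens A (ldualT A)) (coevl A).
Proof.
have Hq := cmap_bot_transpose (cmap_double_pair A).
have Ht : is_cmap (A := cunit G) (B := ldualc (ctens A (crdual A)))
  (lmap (rpair A) ∘ canV I).
  apply: (@cmap_comp _ _ _ (ldualc bot) _ _ _ _ (cmap_canV (cunit G))).
  exact: (@cmap_lmap _ _ st (ctens A (crdual A)) bot _ (cmap_rpair A)).
apply: (mono_split (i := fmap G (bot_transpose (double_pair A)))
  (fmap_inverse G (retractK A))).
rewrite compA -fmapM bot_transpose_coevl Ht -bot_transpose_coevl.
by rewrite [RHS]compA Hq -[RHS]compA.
Qed.

(** The coevaluation of the cofree coalgebra on [X] is a coalgebra morphism;
    apply [counit G X] to its first factor. *)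
Lemma antipode_coevl X :
  fmap G ((idm X ⊗₁ lmap (counit G X)) ∘ coevl X) ∘ phi0 G
  = phi G X (ldual (G X))
    ∘ (idm (G X) ⊗₁ (fmap G (lmap (comult G X)) ∘ antipode (G X)))
    ∘ coevl (G X).
Proof.
rewrite -coevl_map fmapM -compA (cmap_coevl (cofree G X)).
change (str (ctens (cofree G X) (ldualT (cofree G X)))) with
  (phi G (G X) (ldual (G X)) ∘ (comult G X ⊗₁ str (ldualT (cofree G X)))).
rewrite str_ldualT -2!(compA (phi G _ _)) (precomp2 (phi_natural _ _ _)).
congr (_ ∘ _).
by rewrite compA -tensmM comult_counitr fmap1 comp1m.
Qed.

(** The evaluation of the cofree coalgebra on [X] is a coalgebra morphism;
    precompose it with the dual of [counit G X]. *)
Lemma antipode_evl X :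
  phi0 G ∘ evl X ∘ (idm (ldual X) ⊗₁ counit G X)
  = fmap G (evl (G X)) ∘ phi G (ldual (G X)) (G X)
    ∘ (antipode X ⊗₁ comult G X).
Proof.
rewrite -compA -evl_map compA -(cmap_evl (cofree G X)).
change (str (ctens (ldualT (cofree G X)) (cofree G X))) with
  (phi G (ldual (G X)) (G X) ∘ (str (ldualT (cofree G X)) ⊗₁ comult G X)).
rewrite -!compA; congr (_ ∘ (_ ∘ _)).
rewrite -tensmM compm1 str_ldualT -compA -antipode_natural compA -fmapM.
by rewrite -lmap_comp comult_counitr lmap1 fmap1 comp1m.
Qed.

End Hopf.

(** * Antipodes of a star-autonomous monad *)

Theorem proposition5p1 (C : autonomous_category) (T : star_autonomous_monad C) :
  hopf_monad T.
Proof.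
(* A structure on the opposite category of [C], whose left duals are the right
   duals of [C]: it gives the right antipode, its reverse the left one.  The
   (co)evaluation equations change places under duality. *)
pose st := sam_structure T.
pose rst := rev_star st.
split.
- exists (antipode rst); split.
  + move=> X Y f; have /= := @antipode_natural _ _ rst Y X f.
    by rewrite !lmapE !rev_ldual_map !op_rdual_map.
  + move=> X; have /= := @antipode_coevl _ _ rst X.
    by rewrite !lmapE !rev_ldual_map !op_rdual_map fmapM !compA.
  + move=> X; have /= := @antipode_evl _ _ rst X.
    by rewrite !compA.
- exists (antipode st); split.
  + move=> X Y f; have /= := @antipode_natural _ _ st Y X f.
    by rewrite !lmapE !op_ldual_map.
  + move=> X; have /= := @antipode_coevl _ _ st X.
    by rewrite !lmapE !op_ldual_map fmapM !compA.
  + move=> X; have /= := @antipode_evl _ _ st X.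
    by rewrite !compA.
Qed.
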